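(* Let $X$ be a Banach space with $\dim X\ge2$ and let $0\le\nu\le1$. Then $H_\nu(X,B)=2$ if and only if $X$ is not uniformly non-square.
   Context: $S_X$ is the unit sphere of $X$. For $x,y\in X$, $x\perp_B y$ (Birkhoff orthogonality) means $\|x+\lambda y\|\ge\|x\|$ for all real $\lambda$. For $0\le\nu\le1$, $$H_\nu(X,B)=\sup\left\{\frac{\|x+y\|^{\nu}\|x-y\|^{1-\nu}+\|x+y\|^{1-\nu}\|x-y\|^{\nu}}{2}:\ x,y\in S_X,\ x\perp_B y\right\}.$$ $X$ is uniformly non-square if there exists $\delta>0$ such that for all $x,y\in S_X$ either $\frac{\|x-y\|}{2}\le1-\delta$ or $\frac{\|x+y\|}{2}\le1-\delta$. *)

(* Defs.v *)
From mathcomp Require Import all_boot all_order all_algebra.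
From mathcomp Require Import all_classical all_reals all_analysis.

Set Implicit Arguments.
Unset Strict Implicit.
Unset Printing Implicit Defensive.

Import Order.TTheory GRing.Theory Num.Theory.
Import numFieldNormedType.Exports.

Local Open Scope classical_set_scope.
Local Open Scope ring_scope.

Definition unit_sphere (R : realType) (X : normedModType R) : set X :=
  [set x | `|x| = 1].

Definition birkhoff_orthogonal (R : realType) (X : normedModType R)
    (x y : X) : Prop :=
  forall lambda : R, `|x| <= `|x + lambda *: y|.

(* Infinite-dimensional spaces satisfy this for every n. *)
Definition dim_at_least (R : realType) (X : normedModType R) (n : nat) : Prop :=
  exists v : 'I_n -> X, forall c : 'I_n -> R,
    \sum_(i < n) c i *: v i = 0 -> forall i, c i = 0.

Definition H_mean (R : realType) (X : normedModType R) (nu : R) (x y : X) : R :=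
  (`|x + y| `^ nu * `|x - y| `^ (1 - nu)
   + `|x + y| `^ (1 - nu) * `|x - y| `^ nu) / 2.

(* The supremum is taken in R, where [sup] is 0 for a set that is empty or
   unbounded above.  For dim X >= 2 and 0 <= nu <= 1 the set is nonempty, and
   it is bounded by 2 since `|x + y| and `|x - y| are at most 2. *)
Definition H_const (R : realType) (X : normedModType R) (nu : R) : R :=
  sup [set h | exists x y : X,
    [/\ unit_sphere x, unit_sphere y, birkhoff_orthogonal x y
      & h = H_mean nu x y]].

Definition uniformly_non_square (R : realType) (X : normedModType R) : Prop :=
  exists2 delta : R, 0 < delta &
    forall x y : X, unit_sphere x -> unit_sphere y ->
      `|x - y| / 2 <= 1 - delta \/ `|x + y| / 2 <= 1 - delta.

(* Main.v *)
(** If [x, y] are unit vectors with [|x + y|] and [|x - y|] close to [2], then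
    by convexity [t |-> |y + t x|] is at least about [1 + |t|] near [0], while
    its value at [0] is [1]; hence its minimum is attained at some small [a].
    Then [y + a x] is Birkhoff orthogonal to [x], and normalizing it moves it
    only slightly away from [y].  The converse only needs the Heinz mean to be
    at most the arithmetic mean, and the Heinz mean being at least the minimum
    makes the first construction sufficient. *)

Require Import Defs.
From mathcomp Require Import all_boot all_order all_algebra.
From mathcomp Require Import all_classical all_reals all_analysis.
From mathcomp Require Import ring lra.

Import Order.TTheory GRing.Theory Num.Theory.
Import numFieldNormedType.Exports.

Local Open Scope ring_scope.

Section PowerMeans.
Context {R : realType}.
Implicit Types a b m t : R.

(* Tangent-line inequality for [expR] at the weighted mean of the logarithms. *)
Lemma weighted_amgm a b t : 0 < a -> 0 < b -> 0 <= t <= 1 ->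
  a `^ t * b `^ (1 - t) <= t * a + (1 - t) * b.
Proof.
move=> a0 b0 /andP[t0 t1].
rewrite /powR !gt_eqF// -expRD; set c := _ + _.
have ge z : 0 < z -> expR c * (1 + (ln z - c)) <= z.
  move=> z0; have zE : expR c * expR (ln z - c) = z by rewrite -expRD subrKC lnK.
  by rewrite -[leRHS]zE ler_wpM2l ?expR_ge0// expR_ge1Dx.
have := lerD (ler_wpM2l t0 (ge _ a0))
  (ler_wpM2l (_ : 0 <= 1 - t) (ge _ b0)).
rewrite subr_ge0 => /(_ t1); apply: le_trans.
(* As [c] is the weighted mean of [ln a] and [ln b], the linear terms cancel and [expR c]
   remains. *)
by rewrite le_eqVlt; apply/orP; left; apply/eqP; rewrite /c; ring.
Qed.

Lemma powR_weighted_ge m a b t : 0 < m -> m <= a -> m <= b -> 0 <= t <= 1 ->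
  m <= a `^ t * b `^ (1 - t).
Proof.
move=> m0 ma mb /andP[t0 t1].
have {1}-> : m = m `^ t * m `^ (1 - t).
  by rewrite -powRD ?subrKC ?powRr1 ?ltW// oner_eq0.
have [a0 b0] := (lt_le_trans m0 ma, lt_le_trans m0 mb).
apply: ler_pM; rewrite ?powR_ge0//; apply: ge0_ler_powR;
  by rewrite ?nnegrE ?subr_ge0 // ltW.
Qed.

End PowerMeans.

Section Birkhoff.
Context {R : realType} {X : normedModType R}.
Implicit Types (x y z u : X) (k t e : R).

Lemma birkhoff_orthogonal_ge x y : birkhoff_orthogonal x y ->
  `|x| <= `|x + y| /\ `|x| <= `|x - y|.
Proof. by move=> h; have := (h 1, h (-1)); rewrite scaleN1r scale1r => -[]. Qed.

Lemma birkhoff_orthogonal_scalel k x y :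
  birkhoff_orthogonal x y -> birkhoff_orthogonal (k *: x) y.
Proof.
move=> h l; have [->|k0] := eqVneq k 0; first by rewrite scale0r normr0.
have -> : k *: x + l *: y = k *: (x + (k^-1 * l) *: y).
  by rewrite scalerDr scalerA mulVKf.
by rewrite !normrZ ler_wpM2l.
Qed.

Lemma ler_norm_line_near x y t : `|x| = 1 -> t <= 1 ->
  `|y + x| - (1 - t) <= `|y + t *: x|.
Proof.
move=> x1 t1; rewrite lerBlDr.
have -> : y + x = (y + t *: x) + (1 - t) *: x.
  by rewrite scalerBl scale1r -addrA subrKC.
apply: le_trans (ler_normD _ _) _.
by rewrite normrZ x1 mulr1 ger0_norm// subr_ge0.
Qed.

(** Comparing with [t *: (y + x)] rather than [y + x] makes the bound grow with [t] when [|y + x|]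
    exceeds 1, which controls the whole ray. *)
Lemma ler_norm_line_far x y t : `|y| = 1 -> 1 <= t ->
  t * `|y + x| - (t - 1) <= `|y + t *: x|.
Proof.
move=> y1 t1; rewrite lerBlDr -{1}[t]ger0_norm ?(le_trans _ t1)// -normrZ.
have -> : t *: (y + x) = (y + t *: x) + (t - 1) *: y.
  by rewrite scalerBl scale1r scalerDr [y + _]addrC -addrA subrKC addrC.
apply: le_trans (ler_normD _ _) _.
by rewrite [X in _ + X]normrZ y1 mulr1 ger0_norm// subr_ge0.
Qed.

Lemma continuous_norm_line x y : continuous (fun t : R => `|y + t *: x|).
Proof.
move=> t; apply: cvg_norm; apply: cvgD; first exact: cvg_cst.
by apply: cvgZr_tmp; exact: cvg_id.
Qed.

Lemma birkhoff_orthogonal_approx x y e : `|x| = 1 -> `|y| = 1 -> 0 < e < 1 ->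
  2 - e <= `|y + x| -> 2 - e <= `|y - x| ->
  exists a, `|a| <= e /\ birkhoff_orthogonal (y + a *: x) x.
Proof.
move=> x1 y1 /andP[e0 e1] hp hm.
have Nx1 : `|- x| = 1 by rewrite normrN.
have [||a] := @EVT_min R (fun t => `|y + t *: x|) (-1) 1; first by lra.
  by apply: continuous_subspaceT; exact: continuous_norm_line.
rewrite in_itv/= => /andP[a_ge a_le] amin.
have a1 : `|y + a *: x| <= 1.
  by have := amin 0; rewrite in_itv/= scale0r addr0 y1; apply; lra.
have flip t : - t *: - x = t *: x by rewrite scalerN scaleNr opprK.
exists a; split.
  (* The value at [a] is at most 1, but the near bounds make it at least [1 - e + a] and
     [1 - e - a]. *)
  rewrite ler_norml; apply/andP; split.
    by have := ler_norm_line_near (- x) y (- a) Nx1; rewrite flip => /(_ _); lra.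
  by have := ler_norm_line_near x y a x1 a_le; lra.
move=> l; rewrite -addrA -scalerDl; set t := a + l.
(* Outside [[-1, 1]] the far bound gives at least [1 + |t| * (1 - e)], so the minimum over the
   interval is global. *)
have [t1|t1] := leP t 1; last first.
  apply: le_trans a1 _; apply: le_trans (ler_norm_line_far x y t y1 (ltW t1)).
  by nra.
have [t2|t2] := leP (-1) t; first by apply: amin; rewrite in_itv/= t1 t2.
apply: le_trans a1 _; have := ler_norm_line_far (- x) y (- t) y1.
rewrite flip => h; apply: le_trans (h _); last by lra.
by nra.
Qed.

(** Shifting [y] along [x] and then normalizing each cost at most [e], whence [3 * e]. *)
Lemma birkhoff_orthogonal_unit_approx x y e :
  `|x| = 1 -> `|y| = 1 -> 0 < e < 1 ->
  2 - e <= `|y + x| -> 2 - e <= `|y - x| ->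
  exists u, [/\ `|u| = 1, birkhoff_orthogonal u x,
    2 - 3 * e <= `|u + x| & 2 - 3 * e <= `|u - x|].
Proof.
move=> x1 y1 e01 hp hm; have /andP[e0 e1] := e01.
have [a [ae]] := birkhoff_orthogonal_approx _ _ _ x1 y1 e01 hp hm.
set z := y + a *: x => zx.
have zy : `|z - y| <= e by rewrite /z addrAC subrr add0r normrZ x1 mulr1.
have zle : `|z| <= 1.
  by have := zx (- a); rewrite /z -addrA scaleNr subrr addr0 y1.
have zge : 1 - e <= `|z|.
  have := ler_normB z (z - y); rewrite subKr y1; lra.
have z0 : 0 < `|z| by lra.
pose u := `|z|^-1 *: z.
have uz : `|u - z| <= e.
  have -> : u - z = (`|z|^-1 - 1) *: z by rewrite scalerBl scale1r.
  rewrite normrZ -{2}[`|z|]ger0_norm// -normrM mulrBl mul1r mulVf ?gt_eqF//.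
  by rewrite ger0_norm; lra.
have uy : `|u - y| <= 2 * e.
  by have := ler_normD (u - z) (z - y); rewrite subrKA; lra.
exists u; split.
- by rewrite normrZ ger0_norm ?invr_ge0// mulVf ?gt_eqF.
- exact: birkhoff_orthogonal_scalel.
- have := ler_normB (u + x) (u - y).
  by rewrite opprB [u + x]addrC -addrA subrKC [x + y]addrC; lra.
- have := ler_normB (u - x) (u - y).
  by rewrite opprB [u - x]addrC -addrA subrKC [- x + y]addrC; lra.
Qed.

End Birkhoff.

Section HeinzMean.
Context {R : realType} {X : normedModType R} (nu : R).
Hypothesis nu01 : 0 <= nu <= 1.
Implicit Types x y : X.

Lemma H_mean_le x y : 0 < `|x + y| -> 0 < `|x - y| ->
  H_mean nu x y <= (`|x + y| + `|x - y|) / 2.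
Proof.
move=> p0 m0; rewrite /H_mean ler_pM2r ?invr_gt0//.
have := weighted_amgm _ _ _ p0 m0 nu01.
have := weighted_amgm _ _ _ m0 p0 nu01.
rewrite [X in X <= _ -> _]mulrC; lra.
Qed.

Lemma H_mean_ge x y m : 0 < m -> m <= `|x + y| -> m <= `|x - y| ->
  m <= H_mean nu x y.
Proof.
move=> m0 hp hm; rewrite /H_mean ler_pdivlMr//.
have := powR_weighted_ge _ _ _ _ m0 hp hm nu01.
have := powR_weighted_ge _ _ _ _ m0 hm hp nu01.
rewrite [X in _ <= X -> _]mulrC; lra.
Qed.

(** Orthogonality keeps both norms at least 1, so the logarithms in the mean inequality make
    sense. *)
Lemma H_mean_birkhoff_le x y : `|x| = 1 -> birkhoff_orthogonal x y ->
  H_mean nu x y <= (`|x + y| + `|x - y|) / 2.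
Proof.
move=> x1 /birkhoff_orthogonal_ge; rewrite x1 => -[hp hm].
by apply: H_mean_le; apply: lt_le_trans ltr01 _.
Qed.

End HeinzMean.

Theorem theorem3p2 (R : realType) (X : completeNormedModType R) (nu : R)
    (hdim : dim_at_least X 2) (hnu0 : 0 <= nu) (hnu1 : nu <= 1) :
  H_const X nu = 2 <-> ~ uniformly_non_square X.
Proof.
have nu01 : 0 <= nu <= 1 by rewrite hnu0.
rewrite /H_const; set E := (X in sup X).
have E_le2 : ubound E 2.
  move=> _ [x [y [x1 y1 xy ->]]]; rewrite /unit_sphere/= in x1 y1.
  apply: le_trans (H_mean_birkhoff_le _ nu01 _ _ x1 xy) _.
  have := ler_normD x y; have := ler_normB x y; rewrite x1 y1; lra.
split=> [supE [d d0 ns]|not_ns].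
  have Esup : has_sup E.
    (* Without a genuine supremum, [sup E] would be the default 0, not 2. *)
    by apply: contrapT => /sup_out; rewrite supE => /eqP; rewrite pnatr_eq0.
  (* A mean above [2 - d] forces the two norms to sum to more than [4 - 2 * d], whereas [ns] caps
     one at [2 - 2 * d] and the other is at most 2. *)
  have [_ [x [y [x1 y1 xy ->]]]] := sup_adherent d0 Esup.
  rewrite supE; rewrite /unit_sphere/= in x1 y1.
  have := H_mean_birkhoff_le _ nu01 _ _ x1 xy.
  have := ler_normD x y; have := ler_normB x y; rewrite x1 y1.
  by case: (ns x y x1 y1); lra.
have near2 e : 0 < e < 1 -> exists2 h, E h & 2 - 3 * e <= h.
  move=> e01; have /andP[e0 e1] := e01.
  have [x [y [x1 y1 hm hp]]] : exists x y : X,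
      [/\ `|x| = 1, `|y| = 1, 2 - e <= `|y - x| & 2 - e <= `|y + x|].
    apply: contrapT => far; apply: not_ns; exists (e / 2); first lra.
    move=> x y x1 y1; rewrite /unit_sphere/= in x1 y1.
    have [hm|hm] := leP (`|x - y| / 2) (1 - e / 2); first by left.
    right; rewrite leNgt; apply/negP => hp; apply: far.
    by exists x, y; split=> //; [rewrite distrC|rewrite [y + x]addrC]; lra.
  have [u [u1 ux up um]] :=
    birkhoff_orthogonal_unit_approx _ _ _ x1 y1 e01 hp hm.
  exists (H_mean nu u x); first by exists u, x.
  (* For large [e] the bound is not positive, and nonnegativity of the mean suffices. *)
  have [m0|m0] := ltP 0 (2 - 3 * e); first exact: H_mean_ge.
  apply: le_trans m0 _.
  by rewrite /H_mean divr_ge0 ?addr_ge0 ?mulr_ge0 ?powR_ge0.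
have E2 : has_ubound E by exists 2.
apply/eqP; rewrite eq_le; apply/andP; split.
  apply: ge_sup => //.
  by have [|h Eh _] := near2 2^-1; [lra|exists h].
rewrite leNgt; apply/negP => lt2.
(* The 6 makes [3 * e] at most half the gap [2 - sup E], so [2 - 3 * e] exceeds [sup E]; the [1 / 2]
   keeps [e] below 1. *)
pose e := Num.min (1 / 2) ((2 - sup E) / 6).
have [e_half e_gap] : e <= 1 / 2 /\ e <= (2 - sup E) / 6.
  by rewrite /e !ge_min !lexx orbT.
have e0 : 0 < e by rewrite /e lt_min; apply/andP; split; lra.
have [|h Eh he] := near2 e; first lra.
have := ub_le_sup E2 Eh; lra.
Qed.
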